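(* Suppose $\kappa$ is a regular cardinal and $I$ is a normal ideal on $\kappa$. Let $G$ be generic for $P(\kappa)/I$ over $V$ and let $j:V\to V^\kappa/G$ be the corresponding generic ultrapower embedding. Then, for all $\xi<\kappa^+$, the $\xi$-th canonical reflection function $F^\kappa_\xi$ represents $j''\xi$ in the generic ultrapower, that is, $j(F^\kappa_\xi)(\kappa)=j''\xi$.
   Context: Canonical reflection functions: for a regular cardinal $\kappa$ and each ordinal $\xi$ with $\kappa\le\xi<\kappa^+$ fix a bijection $b_{\kappa,\xi}:\kappa\to\xi$ (with $b_{\kappa,\kappa}=\mathrm{id}_\kappa$). For $\xi<\kappa$ let $F^\kappa_\xi(\alpha)=\xi$ for all $\alpha<\kappa$; for $\kappa\le\xi<\kappa^+$ let $F^\kappa_\xi(\alpha)=b_{\kappa,\xi}[\alpha]$ for all $\alpha<\kappa$. Generic ultrapowers: if $I$ is a normal ideal on a regular cardinal $\kappa$ and $G\subseteq P(\kappa)/I$ is generic over $V$, then in $V[G]$ there is a $V$-normal $V$-ultrafilter $U_G\subseteq P(\kappa)^V$ obtained from $G$ and extending the filter dual to $I$. $V^\kappa/G$ denotes the ultrapower of $V$ by $U_G$ (using functions $f:\kappa\to V$ in $V$), and $j:V\to V^\kappa/G$ is the canonical embedding. It has critical point $\kappa$, $\kappa$ is represented by the identity function, and $V^\kappa/G$ is wellfounded at least up to $(\kappa^+)^V$; its wellfounded part is identified with its transitive collapse. As usual $j''\xi=\{j(\eta):\eta<\xi\}$, and the element of $V^\kappa/G$ represented by $F:\kappa\to V$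 is $j(F)(\kappa)$. *)

(* Defs.v *)
From Stdlib Require Import Classical ClassicalEpsilon FunctionalExtensionality
  PropExtensionality ProofIrrelevance.

Set Implicit Arguments.
Unset Strict Implicit.

(* A structure for the language of set theory.  [mem] is an arbitrary binary
   relation, so that the same definitions can be read both in the ground model
   and in its generic ultrapower, whose membership relation need not be
   wellfounded. *)
Record set_structure : Type := SetStructure {
  carrier :> Type;
  mem : carrier -> carrier -> Prop
}.

Arguments mem {s} _ _.

Declare Scope set_theory_scope.
Notation "x ∈ y" := (mem x y) (at level 70) : set_theory_scope.
Local Open Scope set_theory_scope.

(* The schemes of Separation and Replacement must range over first-order
   formulas only.  Their second-order versions would put every subset of a set
   of the model into the model, in particular every generic filter, and there
   would be none for an atomless forcing. *)
Inductive formula : Type :=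
| fmem : nat -> nat -> formula
| feq : nat -> nat -> formula
| fnot : formula -> formula
| fand : formula -> formula -> formula
| for_ : formula -> formula -> formula
| fimp : formula -> formula -> formula
| fall : formula -> formula
| fex : formula -> formula.

Definition scons (A : Type) (x : A) (e : nat -> A) (n : nat) : A :=
  match n with O => x | S m => e m end.

Fixpoint sat (V : set_structure) (e : nat -> V) (phi : formula) : Prop :=
  match phi with
  | fmem i j => e i ∈ e j
  | feq i j => e i = e j
  | fnot p => ~ sat e p
  | fand p q => sat e p /\ sat e q
  | for_ p q => sat e p \/ sat e q
  | fimp p q => sat e p -> sat e q
  | fall p => forall x : V, sat (scons x e) p
  | fex p => exists x : V, sat (scons x e) p
  end.

Section Notions.
Context {V : set_structure}.
Implicit Types x y z a b c d f g k s : V.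

Definition subset x y : Prop := forall z, z ∈ x -> z ∈ y.

Definition is_empty x : Prop := forall z, ~ z ∈ x.

Definition is_upair p x y : Prop := forall z, z ∈ p <-> z = x \/ z = y.

Definition is_opair p x y : Prop :=
  exists s u, is_upair s x x /\ is_upair u x y /\ is_upair p s u.

Definition is_union u x : Prop := forall z, z ∈ u <-> exists y, y ∈ x /\ z ∈ y.

Definition is_successor s x : Prop := forall z, z ∈ s <-> z ∈ x \/ z = x.

Definition maps f x y : Prop := exists p, is_opair p x y /\ p ∈ f.

Definition value f x y : Prop := forall z, maps f x z <-> z = y.

Definition is_function f d : Prop :=
  (forall p, p ∈ f -> exists x y, x ∈ d /\ is_opair p x y) /\
  (forall x, x ∈ d -> exists y, value f x y).

Definition function_to f d c : Prop :=
  is_function f d /\ forall x y, maps f x y -> y ∈ c.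

Definition bijection f d c : Prop :=
  function_to f d c /\ forall y, y ∈ c -> exists! x, maps f x y.

Definition identity_on f d : Prop :=
  is_function f d /\ forall x, x ∈ d -> value f x x.

Definition is_image f a s : Prop :=
  forall y, y ∈ s <-> exists x, x ∈ a /\ maps f x y.

(* In models of Foundation, membership is automatically wellfounded on [x]. *)
Definition is_ordinal x : Prop :=
  (forall y, y ∈ x -> subset y x) /\
  (forall y z, y ∈ x -> z ∈ x -> y ∈ z \/ y = z \/ z ∈ y).

Definition ordinal_le a b : Prop := a ∈ b \/ a = b.

Definition is_limit x : Prop :=
  is_ordinal x /\ (exists y, y ∈ x) /\
  forall y, y ∈ x -> exists z, z ∈ x /\ y ∈ z.

Definition is_omega x : Prop := is_limit x /\ forall y, y ∈ x -> ~ is_limit y.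

Definition is_cardinal k : Prop :=
  is_ordinal k /\ forall a, a ∈ k -> ~ exists f, bijection f a k.

Definition is_regular_cardinal k : Prop :=
  is_cardinal k /\
  (exists w, is_omega w /\ ordinal_le w k) /\
  forall a f, a ∈ k -> function_to f a k ->
    exists b, b ∈ k /\ forall x y, maps f x y -> y ∈ b.

Definition is_successor_cardinal k kplus : Prop :=
  is_cardinal kplus /\ k ∈ kplus /\
  forall l, is_cardinal l -> k ∈ l -> ordinal_le kplus l.

End Notions.

Record ZFC_axioms (V : set_structure) : Prop := {
  ZFC_extensionality : forall x y : V, (forall z, z ∈ x <-> z ∈ y) -> x = y;
  ZFC_foundation : forall x : V, ~ is_empty x ->
    exists y, y ∈ x /\ forall z, z ∈ y -> ~ z ∈ x;
  ZFC_pairing : forall x y : V, exists p, is_upair p x y;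
  ZFC_union : forall x : V, exists u, is_union u x;
  ZFC_powerset : forall x : V, exists p, forall z, z ∈ p <-> subset z x;
  ZFC_infinity : exists w : V,
    (exists o, is_empty o /\ o ∈ w) /\
    forall x, x ∈ w -> exists s, is_successor s x /\ s ∈ w;
  ZFC_separation : forall (phi : formula) (e : nat -> V) (a : V),
    exists s, forall x, x ∈ s <-> x ∈ a /\ sat (scons x e) phi;
  ZFC_replacement : forall (phi : formula) (e : nat -> V) (a : V),
    (forall x, x ∈ a -> exists! y, sat (scons x (scons y e)) phi) ->
    exists s, forall y,
      y ∈ s <-> exists x, x ∈ a /\ sat (scons x (scons y e)) phi;
  ZFC_choice : forall a : V,
    (forall x, x ∈ a -> ~ is_empty x) ->
    (forall x y z, x ∈ a -> y ∈ a -> z ∈ x -> z ∈ y -> x = y) ->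
    exists c, forall x, x ∈ a -> exists! z, z ∈ x /\ z ∈ c
}.

Record ZFC_model : Type := ZFCModel {
  ZFC_structure :> set_structure;
  ZFC_modelP : ZFC_axioms ZFC_structure
}.

Section Functions.
Variable V : ZFC_model.
Implicit Types x y z a b c d f p : V.

Let ext x y : (forall z, z ∈ x <-> z ∈ y) -> x = y.
Proof. apply (ZFC_extensionality (ZFC_modelP V)). Qed.

Lemma upair_unique p q x y : is_upair p x y -> is_upair q x y -> p = q.
Proof. intros hp hq; apply ext; intro z; rewrite (hp z), (hq z); tauto. Qed.

Lemma opair_ex x y : exists p, is_opair p x y.
Proof.
destruct (ZFC_pairing (ZFC_modelP V) x x) as [s hs].
destruct (ZFC_pairing (ZFC_modelP V) x y) as [u hu].
destruct (ZFC_pairing (ZFC_modelP V) s u) as [p hp].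
now exists p, s, u.
Qed.

Lemma opair_unique p q x y : is_opair p x y -> is_opair q x y -> p = q.
Proof.
intros (s & u & hs & hu & hp) (s' & u' & hs' & hu' & hq).
rewrite (upair_unique hs' hs), (upair_unique hu' hu) in hq.
exact (upair_unique hp hq).
Qed.

Lemma opair_inj p x y x' y' :
  is_opair p x y -> is_opair p x' y' -> x = x' /\ y = y'.
Proof.
intros (s & u & hs & hu & hp) (s' & u' & hs' & hu' & hp').
assert (e1 : s = s' \/ s = u') by (apply hp', hp; auto).
assert (e2 : u = s' \/ u = u') by (apply hp', hp; auto).
assert (e3 : u' = s \/ u' = u) by (apply hp, hp'; auto).
assert (ex : x = x').
{ destruct e1 as [e | e].
  - assert (h : x ∈ s') by (rewrite <- e; apply hs; auto).
    apply hs' in h; tauto.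
  - assert (h : x' ∈ s) by (rewrite e; apply hu'; auto).
    apply hs in h; intuition congruence. }
subst x'; split; [reflexivity |].
assert (hy : y ∈ u) by (apply hu; auto).
assert (hy' : y' ∈ u') by (apply hu'; auto).
destruct e2 as [e | e].
- rewrite e in hy; apply hs' in hy; assert (y = x) by tauto; subst y.
  destruct e3 as [e' | e']; rewrite e' in hy'.
  + apply hs in hy'; intuition congruence.
  + apply hu in hy'; intuition congruence.
- rewrite e in hy; apply hu' in hy; destruct hy as [-> | ->]; auto.
  rewrite <- e in hy'; apply hu in hy'; intuition congruence.
Qed.

Lemma function_of_relation (R : V -> V -> Prop) d :
  (exists phi e, forall a p,
    sat (scons a (scons p e)) phi <-> exists y, R a y /\ is_opair p a y) ->
  (forall a, a ∈ d -> exists! y, R a y) ->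
  exists f, is_function f d /\
    forall a, a ∈ d -> forall y, maps f a y <-> R a y.
Proof.
intros (phi & e & hphi) hR.
destruct (ZFC_replacement (ZFC_modelP V) (phi := phi) (e := e) (a := d))
  as [f hf].
{ intros a ha; destruct (hR a ha) as (y & hy & uy).
  destruct (opair_ex a y) as [p hp]; exists p; split.
  - apply hphi; eauto.
  - intros q hq; apply hphi in hq; destruct hq as (y' & hy' & hq).
    rewrite <- (uy _ hy') in hq; exact (opair_unique hp hq). }
assert (hm : forall a, a ∈ d -> forall y, maps f a y <-> R a y).
{ intros a ha y; split.
  - intros (p & hp & hpf); apply hf in hpf; destruct hpf as (a' & _ & h).
    apply hphi in h; destruct h as (y' & hy' & hp').
    now destruct (opair_inj hp hp') as [-> ->].
  - intros hy; destruct (opair_ex a y) as [p hp]; exists p; split; auto.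
    apply hf; exists a; split; auto; apply hphi; eauto. }
exists f; split; [split |]; auto.
- intros p hp; apply hf in hp; destruct hp as (a & ha & h).
  apply hphi in h; destruct h as (y & _ & h); eauto.
- intros a ha; destruct (hR a ha) as (y & hy & uy); exists y; intro z.
  rewrite (hm a ha); split; [intro h; symmetry; auto | now intros ->].
Qed.

Definition fiff (p q : formula) : formula := fand (fimp p q) (fimp q p).

Definition fupair (p x y : nat) : formula :=
  fall (fiff (fmem 0 (S p)) (for_ (feq 0 (S x)) (feq 0 (S y)))).

Definition fopair (p x y : nat) : formula :=
  fex (fex (fand (fupair 1 (S (S x)) (S (S x)))
           (fand (fupair 0 (S (S x)) (S (S y))) (fupair (S (S p)) 1 0)))).

Definition fmaps (f x y : nat) : formula :=
  fex (fand (fopair 0 (S x) (S y)) (fmem 0 (S f))).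

Definition fimage (f a s : nat) : formula :=
  fall (fiff (fmem 0 (S s)) (fex (fand (fmem 0 (S (S a)))
                                       (fmaps (S (S f)) 0 1)))).

Lemma image_ex f a : exists s, is_image f a s.
Proof.
destruct (ZFC_union (ZFC_modelP V) f) as [u hu].
destruct (ZFC_union (ZFC_modelP V) u) as [v hv].
destruct (ZFC_separation (ZFC_modelP V)
  (fex (fand (fmem 0 3) (fmaps 2 0 1))) (scons f (scons a (fun _ => a))) v)
  as [s hs].
exists s; intro y; rewrite (hs y); split.
- intros (_ & x & hx & hm); exists x; split; [exact hx | exact hm].
- intros (x & hx & hm); split; [| exists x; split; [exact hx | exact hm]].
  destruct hm as (p & (s0 & u0 & _ & h2 & h3) & hp).
  apply hv; exists u0; split; [apply hu; exists p; split; auto |].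
  + apply h3; auto.
  + apply h2; auto.
Qed.

Lemma image_unique f a s s' : is_image f a s -> is_image f a s' -> s = s'.
Proof. intros h h'; apply ext; intro z; rewrite (h z), (h' z); tauto. Qed.

Lemma constant_function_ex d c :
  exists f, is_function f d /\ forall a, a ∈ d -> value f a c.
Proof.
destruct (@function_of_relation (fun _ y => y = c) d) as (f & hf & hv).
- exists (fex (fand (feq 0 3) (fopair 2 1 0))), (fun _ => c).
  intros a p; reflexivity.
- intros a _; exists c; split; auto.
- exists f; split; auto.
Qed.

Lemma identity_function_ex d : exists f, identity_on f d.
Proof.
destruct (@function_of_relation (fun a y => y = a) d) as (f & hf & hv).
- exists (fex (fand (feq 0 1) (fopair 2 1 0))), (fun _ => d).
  intros a p; reflexivity.
- intros a _; exists a; split; auto.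
- exists f; split; [exact hf | exact hv].
Qed.

Lemma image_function_ex f d :
  exists g, is_function g d /\
    forall a, a ∈ d -> exists s, value g a s /\ is_image f a s.
Proof.
destruct (@function_of_relation (is_image f) d) as (g & hg & hv).
- exists (fex (fand (fimage 3 1 0) (fopair 2 1 0))), (fun _ => f).
  intros a p; reflexivity.
- intros a _; destruct (image_ex f a) as [s hs]; exists s; split; auto.
  intros s' hs'; exact (image_unique hs hs').
- exists g; split; auto; intros a ha; destruct (image_ex f a) as [s hs].
  exists s; split; auto; intro z; rewrite (hv a ha z).
  split; [intro h; exact (image_unique h hs) | now intros ->].
Qed.

Definition constant_function d c : V :=
  proj1_sig (constructive_indefinite_description _ (constant_function_ex d c)).

Lemma constant_functionP d c :
  is_function (constant_function d c) d /\
  forall a, a ∈ d -> value (constant_function d c) a c.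
Proof.
unfold constant_function; now destruct (constructive_indefinite_description _ _).
Qed.

Definition identity_function d : V :=
  proj1_sig (constructive_indefinite_description _ (identity_function_ex d)).

Lemma identity_functionP d : identity_on (identity_function d) d.
Proof.
unfold identity_function; now destruct (constructive_indefinite_description _ _).
Qed.

(* [b xi] is the bijection from [kappa] onto [xi], for [xi] in the interval
   from [kappa] (included) to its successor cardinal [kplus] (excluded). *)
Definition reflection_bijections (kappa kplus : V) (b : V -> V) : Prop :=
  (forall xi, ordinal_le kappa xi -> xi ∈ kplus -> bijection (b xi) kappa xi) /\
  identity_on (b kappa) kappa.

Definition is_reflection_function (kappa : V) (b : V -> V) (xi f : V) : Prop :=
  is_function f kappa /\
  (xi ∈ kappa -> forall a, a ∈ kappa -> value f a xi) /\
  (~ xi ∈ kappa -> forall a, a ∈ kappa ->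
    exists s, value f a s /\ is_image (b xi) a s).

Lemma reflection_function_ex (kappa : V) (b : V -> V) (xi : V) :
  exists f, is_reflection_function kappa b xi f.
Proof.
destruct (classic (xi ∈ kappa)) as [h | h].
- destruct (constant_function_ex kappa xi) as (f & hf & hv).
  exists f; split; [| split]; tauto.
- destruct (image_function_ex (b xi) kappa) as (f & hf & hv).
  exists f; split; [| split]; tauto.
Qed.

Definition reflection_function (kappa : V) (b : V -> V) (xi : V) : V :=
  proj1_sig (constructive_indefinite_description _
    (reflection_function_ex kappa b xi)).

Lemma reflection_functionP (kappa : V) (b : V -> V) (xi : V) :
  is_reflection_function kappa b xi (reflection_function kappa b xi).
Proof.
unfold reflection_function; now destruct (constructive_indefinite_description _ _).
Qed.

End Functions.

Section Ideals.
Context {V : ZFC_model}.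
Implicit Types kappa I X Y D s c d : V.

Definition is_ideal kappa I : Prop :=
  (forall X, X ∈ I -> subset X kappa) /\
  (forall X, is_empty X -> X ∈ I) /\
  ~ kappa ∈ I /\
  (forall X Y, X ∈ I -> subset Y X -> Y ∈ I) /\
  (forall X Y Z : V, X ∈ I -> Y ∈ I ->
    (forall z, z ∈ Z <-> z ∈ X \/ z ∈ Y) -> Z ∈ I).

Definition contains_singletons kappa I : Prop :=
  forall a X, a ∈ kappa -> is_upair X a a -> X ∈ I.

(* Closure under unions of sequences of length less than [kappa]. *)
Definition is_complete kappa I : Prop :=
  forall c s D, c ∈ kappa -> function_to s c I ->
    (forall b, b ∈ D <-> exists a X, maps s a X /\ b ∈ X) -> D ∈ I.

(* Closure under diagonal unions of [kappa]-sequences. *)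
Definition closed_under_diagonal_unions kappa I : Prop :=
  forall s D, function_to s kappa I ->
    (forall b, b ∈ D <->
       b ∈ kappa /\ exists a X, a ∈ b /\ maps s a X /\ b ∈ X) -> D ∈ I.

Definition is_normal_ideal kappa I : Prop :=
  is_ideal kappa I /\ contains_singletons kappa I /\ is_complete kappa I /\
  closed_under_diagonal_unions kappa I.

Definition difference_in X Y I : Prop :=
  exists D, D ∈ I /\ forall z, z ∈ D <-> z ∈ X /\ ~ z ∈ Y.

(* [c] is the element of P(kappa)/I determined by [X]: the set of all
   [Y] whose symmetric difference with [X] is in [I]. *)
Definition ideal_class kappa I X c : Prop :=
  subset X kappa /\
  forall Y, Y ∈ c <->
    subset Y kappa /\ difference_in X Y I /\ difference_in Y X I.

(* The zero element of P(kappa)/I is not a condition. *)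
Definition condition kappa I c : Prop :=
  exists X, ideal_class kappa I X c /\ ~ X ∈ I.

Definition condition_le kappa I c d : Prop :=
  exists X Y, ideal_class kappa I X c /\ ideal_class kappa I Y d /\
    difference_in X Y I.

Definition is_dense kappa I D : Prop :=
  (forall d, d ∈ D -> condition kappa I d) /\
  forall c, condition kappa I c -> exists d, d ∈ D /\ condition_le kappa I d c.

(* [G] is a subset of the forcing which need not belong to [V], whereas the
   dense sets it has to meet are the elements of [V]. *)
Definition is_generic kappa I (G : V -> Prop) : Prop :=
  (forall c, G c -> condition kappa I c) /\
  (exists c, G c) /\
  (forall c d, G c -> condition kappa I d -> condition_le kappa I c d -> G d) /\
  (forall c d, G c -> G d ->
    exists e, G e /\ condition_le kappa I e c /\ condition_le kappa I e d) /\
  (forall D, is_dense kappa I D -> exists d, d ∈ D /\ G d).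

Definition generic_ultrafilter kappa I (G : V -> Prop) X : Prop :=
  exists c, ideal_class kappa I X c /\ G c.

End Ideals.

Section Ultrapower.
Context {V : ZFC_model}.
Variables (kappa : V) (U : V -> Prop).

Definition almost_everywhere (P : V -> Prop) : Prop :=
  exists X : V, U X /\ forall a, a ∈ X <-> a ∈ kappa /\ P a.

Definition ultra_eq (f g : V) : Prop :=
  almost_everywhere (fun a => exists y, value f a y /\ value g a y).

Definition ultra_mem (f g : V) : Prop :=
  almost_everywhere (fun a => exists y z, value f a y /\ value g a z /\ y ∈ z).

Definition function_class (f : V) : V -> Prop :=
  fun g => is_function g kappa /\ ultra_eq f g.

Definition ultrapower_carrier : Type :=
  {c : V -> Prop | exists f, is_function f kappa /\ c = function_class f}.

Definition represents (f : V) (x : ultrapower_carrier) : Prop :=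
  proj1_sig x f.

Definition ultrapower : set_structure :=
  @SetStructure ultrapower_carrier
    (fun x y => exists f g, represents f x /\ represents g y /\ ultra_mem f g).

Definition represented_by (f : V) (hf : is_function f kappa) : ultrapower :=
  exist _ (function_class f) (ex_intro _ f (conj hf eq_refl)).

Definition ultrapower_embedding (x : V) : ultrapower :=
  represented_by (proj1 (constant_functionP kappa x)).

(* The element of the ultrapower represented by the identity function; this is
   [kappa] once the wellfounded part of the ultrapower is identified with its
   transitive collapse. *)
Definition ultrapower_kappa : ultrapower :=
  represented_by (proj1 (identity_functionP kappa)).

Definition is_pointwise_image (xi : V) (x : ultrapower) : Prop :=
  forall y : ultrapower,
    y ∈ x <-> exists eta : V, eta ∈ xi /\ y = ultrapower_embedding eta.

End Ultrapower.

(* Main.v *)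
(* By genericity, a family in [V] such that every positive set has a positive
   subset below one of its members contains an element of [U].  For the sets
   {a : f a = h c}, closure of [I] under diagonal unions turns this into Fodor's
   lemma for [U].  Writing [F a = h[a]] almost everywhere, where [h] is the
   identity on [xi] if [xi] is less than [kappa] and the bijection [b xi]
   otherwise, a function with [f a] in [h[a]] almost everywhere is almost
   everywhere equal to some constant [h c]; conversely each [h c] is in [h[a]]
   for all [a > c], hence almost everywhere. *)

From Stdlib Require Import Classical FunctionalExtensionality
  PropExtensionality ProofIrrelevance.
Require Import Defs.

Set Implicit Arguments.
Unset Strict Implicit.

Local Open Scope set_theory_scope.

(* [opair_inj] without the axioms of ZFC, so that it applies in the ultrapower. *)
Lemma structure_opair_inj (M : set_structure) (p x y x' y' : M) :
  is_opair p x y -> is_opair p x' y' -> x = x' /\ y = y'.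
Proof.
intros (s & u & hs & hu & hp) (s' & u' & hs' & hu' & hp').
assert (hss : s ∈ p) by (apply hp; auto).
assert (huu : u ∈ p) by (apply hp; auto).
assert (huu' : u' ∈ p) by (apply hp'; auto).
apply hp' in hss; apply hp' in huu; apply hp in huu'.
pose proof (proj2 (hs x) (or_introl eq_refl)) as xs.
pose proof (proj2 (hu x) (or_introl eq_refl)) as xu.
pose proof (proj2 (hu y) (or_intror eq_refl)) as yu.
pose proof (proj2 (hu' x') (or_introl eq_refl)) as xu'.
pose proof (proj2 (hu' y') (or_intror eq_refl)) as yu'.
assert (ex : x = x').
{ destruct hss as [e | e]; subst.
  - apply hs' in xs; tauto.
  - apply hs in xu'; intuition congruence. }
subst x'; split; [reflexivity |].
destruct huu as [e | e]; subst.
- apply hs' in yu; destruct huu' as [e | e]; subst.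
  + apply hs in yu'; intuition congruence.
  + apply hu in yu'; intuition congruence.
- apply hu' in yu; apply hu in yu'; intuition congruence.
Qed.

(** * First-order formulas for inclusion, values and ideal classes *)

Definition fsubset (x y : nat) : formula :=
  fall (fimp (fmem 0 (S x)) (fmem 0 (S y))).

Definition fvalue (f x y : nat) : formula :=
  fall (fiff (fmaps (S f) (S x) 0) (feq 0 (S y))).

Definition fdifference_in (x y i : nat) : formula :=
  fex (fand (fmem 0 (S i))
    (fall (fiff (fmem 0 1)
      (fand (fmem 0 (S (S x))) (fnot (fmem 0 (S (S y)))))))).

Definition fideal_class (k i x c : nat) : formula :=
  fand (fsubset x k)
    (fall (fiff (fmem 0 (S c))
      (fand (fsubset 0 (S k))
        (fand (fdifference_in (S x) 0 (S i)) (fdifference_in 0 (S x) (S i)))))).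

(** * Ordinals, functions and pairs inside a model of ZFC *)

Section SetTheory.
Variable V : ZFC_model.
Implicit Types x y z a c d f g p : V.

(** For the formulas used here, [sat] unfolds by computation to the intended predicate, so instances
    are closed by [exact] or restated by [change]. *)
Lemma separation (phi : formula) (e : nat -> V) a :
  exists s, forall x, x ∈ s <-> x ∈ a /\ sat (scons x e) phi.
Proof. exact (ZFC_separation (ZFC_modelP V) phi e a). Qed.

Lemma powerset_ex a : exists p, forall z, z ∈ p <-> subset z a.
Proof. exact (ZFC_powerset (ZFC_modelP V) a). Qed.

Lemma mem_asym x y : x ∈ y -> ~ y ∈ x.
Proof.
intros h h'.
destruct (ZFC_pairing (ZFC_modelP V) x y) as [p hp].
destruct (ZFC_foundation (ZFC_modelP V) (x := p)) as (m & hm & hmin).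
{ intro he; apply (he x), hp; auto. }
apply hp in hm; destruct hm as [-> | ->].
- apply (hmin y h'), hp; auto.
- apply (hmin x h), hp; auto.
Qed.

(** By linearity of [k], the only other cases are [x = z] and [z ∈ x]. Foundation excludes them: the
    first is a 2-cycle, and for the second it is applied to the set with elements [x], [y], [z],
    which would be a 3-cycle. *)
Lemma ordinal_mem_trans x y z k :
  is_ordinal k -> z ∈ k -> x ∈ y -> y ∈ z -> x ∈ z.
Proof.
intros [ht hlin] zk xy yz.
assert (yk : y ∈ k) by exact (ht z zk y yz).
assert (xk : x ∈ k) by exact (ht y yk x xy).
destruct (hlin x z xk zk) as [h | [-> | zx]]; auto.
{ destruct (mem_asym xy yz). }
exfalso.
destruct (separation (for_ (feq 0 1) (for_ (feq 0 2) (feq 0 3)))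
  (scons x (scons y (fun _ => z))) k) as [p hp].
change (forall w, w ∈ p <-> w ∈ k /\ (w = x \/ w = y \/ w = z)) in hp.
destruct (ZFC_foundation (ZFC_modelP V) (x := p)) as (m & hm & hmin).
{ intro he; apply (he x), hp; auto. }
apply hp in hm; destruct hm as (_ & [-> | [-> | ->]]).
- apply (hmin z zx), hp; auto.
- apply (hmin x xy), hp; auto.
- apply (hmin y yz), hp; auto.
Qed.

Lemma difference_ex x y : exists d, forall z, z ∈ d <-> z ∈ x /\ ~ z ∈ y.
Proof. exact (separation (fnot (fmem 0 1)) (fun _ => y) x). Qed.

Lemma intersection_ex x y : exists d, forall z, z ∈ d <-> z ∈ x /\ z ∈ y.
Proof. exact (separation (fmem 0 1) (fun _ => y) x). Qed.

Lemma value_maps f a y : value f a y -> maps f a y.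
Proof. intro h; now apply h. Qed.

Lemma function_total f d a : is_function f d -> a ∈ d -> exists y, value f a y.
Proof. intros [_ h]; apply h. Qed.

Lemma function_domain f d a y : is_function f d -> maps f a y -> a ∈ d.
Proof.
intros [h _] (p & hp & hpf); destruct (h p hpf) as (a' & y' & ha & hp').
now destruct (opair_inj hp hp') as [-> _].
Qed.

Lemma maps_value f d a y : is_function f d -> maps f a y -> value f a y.
Proof.
intros hf h.
destruct (function_total hf (function_domain hf h)) as [z hz].
pose proof h as h'; apply hz in h'; now subst z.
Qed.

Lemma value_unique f a y z : value f a y -> value f a z -> y = z.
Proof. intros h h'; now apply h', h. Qed.

Lemma maps_unique f d a y z :
  is_function f d -> maps f a y -> maps f a z -> y = z.
Proof. intros hf h h'; exact (value_unique (maps_value hf h) (maps_value hf h')). Qed.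

(* Where [R a] is empty, the function takes the junk value [a]. *)
Lemma function_of_partial_relation (phi : formula) (e : nat -> V)
    (R : V -> V -> Prop) d :
  (forall y a p, sat (scons y (scons a (scons p e))) phi <-> R a y) ->
  (forall a y z, a ∈ d -> R a y -> R a z -> y = z) ->
  exists f, is_function f d /\
    forall a, a ∈ d -> (exists y, R a y) -> forall y, maps f a y <-> R a y.
Proof.
intros hphi hR.
destruct (@function_of_relation V
  (fun a y => R a y \/ ~ (exists z, R a z) /\ y = a) d) as (f & hf & hm).
(* The first disjunct codes the pair [(a, y)] with [R a y]; the second codes [(a, a)] when [R a] is
   empty. *)
- exists (for_ (fex (fand phi (fopair 2 1 0)))
               (fand (fnot (fex phi)) (fopair 1 0 0))), e.
  intros a p.
  change ((exists y, sat (scons y (scons a (scons p e))) phi /\ is_opair p a y)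
    \/ ~ (exists y, sat (scons y (scons a (scons p e))) phi) /\ is_opair p a a
    <-> exists y, (R a y \/ ~ (exists z, R a z) /\ y = a) /\ is_opair p a y).
  split.
  + intros [(y & hy & hp) | [hn hp]].
    * exists y; split; auto; left; now apply (hphi y a p).
    * exists a; split; auto; right; split; auto.
      intros [z hz]; apply hn; exists z; now apply hphi.
  + intros (y & [hy | [hn ->]] & hp).
    * left; exists y; split; auto; now apply hphi.
    * right; split; auto; intros [z hz]; apply hn; exists z.
      now apply (hphi z a p).
- intros a ha; destruct (classic (exists z, R a z)) as [[y hy] | hn].
  + exists y; split; auto; intros z [hz | [hn _]]; [eauto |].
    destruct hn; eauto.
  + exists a; split; auto; intros z [hz | [_ hz]]; auto; destruct hn; eauto.
- exists f; split; auto; intros a ha he y; rewrite (hm a ha); tauto.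
Qed.

(** The pointwise unordered pair of two functions, from which pairs in the ultrapower are
    represented. *)
Lemma pairing_function_ex f g d :
  is_function f d -> is_function g d ->
  exists h, is_function h d /\
    forall a x y p, value f a x -> value g a y -> value h a p -> is_upair p x y.
Proof.
intros hf hg.
(* Under the two quantifiers, index 2 is the value, 3 the argument, 4 the coded pair, and 5 and 6
   are [f] and [g]. *)
destruct (@function_of_partial_relation
  (fex (fex (fand (fmaps 5 3 1) (fand (fmaps 6 3 0) (fupair 2 1 0)))))
  (scons f (scons g (fun _ => f)))
  (fun a p => exists x y, maps f a x /\ maps g a y /\ is_upair p x y) d)
  as (h & hh & hm).
- intros; reflexivity.
- intros a p q _ (x & y & hx & hy & hp) (x' & y' & hx' & hy' & hq).
  rewrite (maps_unique hf hx' hx), (maps_unique hg hy' hy) in hq.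
  exact (upair_unique hp hq).
- exists h; split; auto; intros a x y p hx hy hp.
  apply value_maps in hx, hy, hp.
  apply hm in hp.
  + destruct hp as (x' & y' & hx' & hy' & hp).
    now rewrite (maps_unique hf hx hx'), (maps_unique hg hy hy').
  + exact (function_domain hf hx).
  + destruct (ZFC_pairing (ZFC_modelP V) x y); eauto 6.
Qed.

(** The coordinates are controlled only where [f] takes an ordered pair as value. This is enough for
    functions that are pair-valued merely almost everywhere. *)
Lemma projections_ex f d :
  is_function f d ->
  exists g h, is_function g d /\ is_function h d /\
    forall a p x y, value f a p -> is_opair p x y ->
      value g a x /\ value h a y.
Proof.
intros hf.
destruct (@function_of_partial_relation
  (fex (fex (fand (fmaps 5 3 1) (fopair 1 2 0)))) (fun _ => f)
  (fun a x => exists p y, maps f a p /\ is_opair p x y) d) as (g & hg & hgm).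
{ intros; reflexivity. }
{ intros a x x' _ (p & y & hp & ho) (p' & y' & hp' & ho').
  rewrite (maps_unique hf hp' hp) in ho'; now destruct (opair_inj ho ho'). }
destruct (@function_of_partial_relation
  (fex (fex (fand (fmaps 5 3 1) (fopair 1 0 2)))) (fun _ => f)
  (fun a y => exists p x, maps f a p /\ is_opair p x y) d) as (h & hh & hhm).
{ intros; reflexivity. }
{ intros a y y' _ (p & x & hp & ho) (p' & x' & hp' & ho').
  rewrite (maps_unique hf hp' hp) in ho'; now destruct (opair_inj ho ho'). }
exists g, h; split; [| split]; auto.
intros a p x y hp ho; apply value_maps in hp.
pose proof (function_domain hf hp) as ha.
split; [apply (maps_value hg), hgm | apply (maps_value hh), hhm]; eauto 6.
Qed.

End SetTheory.

(** * Ideals and the ultrafilter given by a generic filter *)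

Section NormalIdeal.
Variables (V : ZFC_model) (kappa I : V).
Hypothesis hI : is_ideal kappa I.
Implicit Types X Y Z A B W S c d : V.

Lemma ideal_subset X Y : Y ∈ I -> subset X Y -> X ∈ I.
Proof. apply hI. Qed.

Lemma ideal_cover X A B :
  A ∈ I -> B ∈ I -> (forall z, z ∈ X -> z ∈ A \/ z ∈ B) -> X ∈ I.
Proof.
intros hA hB h.
destruct (intersection_ex X A) as [A' hA'].
destruct (difference_ex X A) as [B' hB'].
destruct hI as (_ & _ & _ & _ & hU); apply (hU A' B').
- apply (ideal_subset hA); intros z hz; now apply hA'.
- apply (ideal_subset hB); intros z hz; apply hB' in hz; destruct hz.
  destruct (h z); tauto.
- intro z; rewrite (hA' z), (hB' z); destruct (classic (z ∈ A)); tauto.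
Qed.

Lemma difference_in_cover X Y A B :
  A ∈ I -> B ∈ I -> (forall z, z ∈ X -> z ∈ Y \/ z ∈ A \/ z ∈ B) ->
  difference_in X Y I.
Proof.
intros hA hB h; destruct (difference_ex X Y) as [D hD].
exists D; split; auto; apply (ideal_cover hA hB).
intros z hz; apply hD in hz; destruct hz; destruct (h z); tauto.
Qed.

Lemma empty_in_ideal : exists E, E ∈ I.
Proof.
destruct (difference_ex kappa kappa) as [E hE]; exists E.
apply hI; intros z hz; apply hE in hz; tauto.
Qed.

Lemma difference_in_subset X Y : subset X Y -> difference_in X Y I.
Proof. destruct empty_in_ideal as [E hE]; intro h; apply (difference_in_cover hE hE); auto. Qed.

Lemma difference_in_inter X A B Y :
  difference_in X A I -> difference_in X B I ->
  (forall z, z ∈ X -> z ∈ A -> z ∈ B -> z ∈ Y) -> difference_in X Y I.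
Proof.
intros (D & hD & eD) (E & hE & eE) h.
apply (difference_in_cover hD hE); intros z hz; rewrite (eD z), (eE z).
destruct (classic (z ∈ A)), (classic (z ∈ B)); auto.
Qed.

Lemma difference_in_trans X Y Z :
  difference_in X Y I -> difference_in Y Z I -> difference_in X Z I.
Proof.
intros (D & hD & eD) (E & hE & eE).
apply (difference_in_cover hD hE); intros z hz; rewrite (eD z), (eE z).
destruct (classic (z ∈ Y)), (classic (z ∈ Z)); tauto.
Qed.

Lemma difference_in_ideal X Y : difference_in X Y I -> Y ∈ I -> X ∈ I.
Proof.
intros (D & hD & eD) hY; apply (ideal_cover hD hY); intros z hz.
rewrite (eD z); destruct (classic (z ∈ Y)); tauto.
Qed.

Lemma ideal_class_ex X : subset X kappa -> exists c, ideal_class kappa I X c.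
Proof.
intro hX; destruct (powerset_ex kappa) as [P hP].
destruct (separation (fand (fdifference_in 1 0 2) (fdifference_in 0 1 2))
  (scons X (fun _ => I)) P) as [c hc].
exists c; split; auto; intro Y; rewrite <- (hP Y); exact (hc Y).
Qed.

Lemma ideal_class_difference X Y c :
  ideal_class kappa I X c -> ideal_class kappa I Y c -> difference_in X Y I.
Proof.
intros [_ hX] [hYk hY]; apply hX, hY; split; auto.
split; apply difference_in_subset; intros z hz; exact hz.
Qed.

Variable G : V -> Prop.
Hypothesis hG : is_generic kappa I G.

Let U := generic_ultrafilter kappa I G.

Lemma ultrafilter_subset X : U X -> subset X kappa.
Proof. now intros (c & [h _] & _). Qed.

(** A condition has a positive representative, and positivity does not depend on the
    representative. *)
Lemma ultrafilter_positive X : U X -> ~ X ∈ I.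
Proof.
intros (c & hc & Gc) h; destruct hG as (hcond & _).
destruct (hcond c Gc) as (Y & hY & nY).
apply nY, (difference_in_ideal (ideal_class_difference hY hc) h).
Qed.

(** Inclusion modulo [I] is the order of the forcing and [G] is upward closed; positivity of [X]
    passes to [Y], so the class of [Y] is a condition. *)
Lemma ultrafilter_up X Y :
  U X -> subset Y kappa -> difference_in X Y I -> U Y.
Proof.
intros hX hY hd; pose proof (ultrafilter_positive hX) as pX.
destruct hX as (c & hc & Gc), (ideal_class_ex hY) as [d hd'].
exists d; split; auto; destruct hG as (_ & _ & hup & _).
apply (hup c); auto.
- exists Y; split; auto; intro h; apply pX, (difference_in_ideal hd h).
- now exists X, Y.
Qed.

(** Two conditions of [G] have a common extension in [G]; a representative of it is included modulo
    [I] in both [X] and [Y], hence in [Z]. *)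
Lemma ultrafilter_inter X Y Z :
  U X -> U Y -> subset Z kappa ->
  (forall z, z ∈ X -> z ∈ Y -> z ∈ Z) -> U Z.
Proof.
intros (c & hc & Gc) (d & hd & Gd) hZ h.
destruct hG as (_ & _ & _ & hdir & _).
destruct (hdir c d Gc Gd) as (e & Ge & (A & A' & hA & hA' & lA)
  & (B & B' & hB & hB' & lB)).
apply (@ultrafilter_up A); [now exists e | auto |].
apply (@difference_in_inter A X Y); auto.
- exact (difference_in_trans lA (ideal_class_difference hA' hc)).
- apply (difference_in_trans (ideal_class_difference hA hB)).
  exact (difference_in_trans lB (ideal_class_difference hB' hd)).
Qed.

(** The classes of positive sets included in some member of [W] form a dense set [D]. A condition in
    both [G] and [D] lies below a member of [W], which is then in [U]. *)
Lemma generic_meets W :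
  (forall Y, Y ∈ W -> subset Y kappa) ->
  (forall X, subset X kappa -> ~ X ∈ I ->
    exists Y Z, Y ∈ W /\ ~ Z ∈ I /\ subset Z X /\ subset Z Y) ->
  exists Y, Y ∈ W /\ U Y.
Proof.
intros hW hX.
(* A class is a set of subsets of [kappa], so the double power set [Q] bounds [D] and Separation
   applies. *)
destruct (powerset_ex kappa) as [P hP], (powerset_ex P) as [Q hQ].
destruct (separation (fex (fand (fideal_class 2 3 0 1)
    (fand (fnot (fmem 0 3)) (fex (fand (fmem 0 5) (fsubset 1 0))))))
  (scons kappa (scons I (fun _ => W))) Q) as [D hD].
change (forall c, c ∈ D <-> c ∈ Q /\ exists X, ideal_class kappa I X c /\
  ~ X ∈ I /\ exists Y, Y ∈ W /\ subset X Y) in hD.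
destruct hG as (_ & _ & _ & _ & hgen).
destruct (hgen D) as (c & hc & Gc).
- split.
  + intros c hc; apply hD in hc; destruct hc as (_ & X & hc & nX & _).
    now exists X.
  + intros c (X & hc & nX).
    destruct (hX X (proj1 hc) nX) as (Y & Z & hY & nZ & ZX & ZY).
    assert (Zk : subset Z kappa) by (intros z hz; apply (proj1 hc), ZX, hz).
    destruct (ideal_class_ex Zk) as [d hd]; exists d; split.
    * apply hD; split; [| exists Z; eauto].
      apply hQ; intros A hA; apply hP; now apply hd.
    * exists Z, X; split; [| split]; auto; now apply difference_in_subset.
- apply hD in hc; destruct hc as (_ & X & hc & _ & Y & hY & XY).
  exists Y; split; auto; apply (@ultrafilter_up X); auto.
  + now exists c.
  + now apply difference_in_subset.
Qed.

(** Genericity for the family with members [A] and [B]: a positive set has a positive intersection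
    with one of them, since [I] is closed under finite unions. *)
Lemma ultrafilter_ultra A B :
  (forall z, z ∈ kappa <-> z ∈ A \/ z ∈ B) -> U A \/ U B.
Proof.
intros h; destruct (ZFC_pairing (ZFC_modelP V) A B) as [W hW].
destruct (@generic_meets W) as (Y & hY & UY).
- intros Y hY z hz; apply hW in hY; apply h.
  destruct hY; subst; auto.
- intros X hX nX; destruct (intersection_ex X A) as [A' hA'].
  destruct (intersection_ex X B) as [B' hB'].
  destruct (classic (A' ∈ I)) as [iA | nA].
  + exists B, B'; split; [apply hW; auto |]; split.
    * intro iB; apply nX, (ideal_cover iA iB); intros z hz.
      rewrite (hA' z), (hB' z); pose proof (proj1 (h z) (hX z hz)); tauto.
    * split; intros z hz; now apply hB'.
  + exists A, A'; split; [apply hW; auto |]; split; auto.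
    split; intros z hz; now apply hA'.
- apply hW in hY; destruct hY; subst; auto.
Qed.

Lemma ultrafilter_complement N B :
  N ∈ I -> subset N kappa ->
  (forall z, z ∈ B <-> z ∈ kappa /\ ~ z ∈ N) -> U B.
Proof.
intros hN Nk hB; destruct (@ultrafilter_ultra N B) as [h | h]; auto.
- intro z; rewrite (hB z); split.
  + intro hz; destruct (classic (z ∈ N)); tauto.
  + intros [hz | hz]; [auto | tauto].
- destruct (ultrafilter_positive h hN).
Qed.

(** * Pressing down, and sets containing a tail of [kappa] *)

Hypothesis hordinal : is_ordinal kappa.

(** [W] collects the sets [Y] such that a single [c] satisfies [f a = h c] for all [a] in both [Y]
    and [S]. If a positive [X] had no positive subset in [W], the set of [a] in [X] and [S] with
    [f a = h c] would be in [I] for each [c], and diagonal unions would put [X] in [I]. *)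
Lemma pressing_down f h S :
  closed_under_diagonal_unions kappa I ->
  U S ->
  (forall a, a ∈ S -> exists c y, c ∈ a /\ maps h c y /\ maps f a y) ->
  exists Y c, U Y /\ c ∈ kappa /\
    forall a, a ∈ Y -> exists y, maps h c y /\ maps f a y.
Proof.
intros hdiag US hS; pose proof (ultrafilter_subset US) as Sk.
destruct (powerset_ex kappa) as [P hP].
destruct (separation (fex (fand (fmem 0 2)
    (fall (fimp (fmem 0 2) (fimp (fmem 0 4)
      (fex (fand (fmaps 6 2 0) (fmaps 7 1 0))))))))
  (scons kappa (scons S (scons h (fun _ => f)))) P) as [W hW].
change (forall Y, Y ∈ W <-> Y ∈ P /\ exists c, c ∈ kappa /\
  forall a, a ∈ Y -> a ∈ S -> exists y, maps h c y /\ maps f a y) in hW.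
destruct (@generic_meets W) as (Y & hY & UY).
- intros Y hY; apply hP; now apply hW.
- intros X hX nX; apply NNPP; intro hn.
  assert (small : forall Y, Y ∈ W -> subset Y X -> Y ∈ I).
  { intros Y hY YX; apply NNPP; intro nY; apply hn.
    exists Y, Y; split; [| split; [| split]]; auto; intros z hz; exact hz. }
  destruct (intersection_ex X S) as [T hT], (difference_ex X S) as [E hE].
  (* [X] splits into [T], the diagonal union of small sets, and [E], which is disjoint from [S] and
     so satisfies the condition defining [W] vacuously. *)
  apply nX, (@ideal_cover X T E).
  + destruct (@function_of_partial_relation V
      (fall (fiff (fmem 0 1) (fand (fmem 0 4)
        (fex (fand (fmaps 6 3 0) (fmaps 7 1 0))))))
      (scons T (scons h (fun _ => f)))
      (fun c Z => forall a, a ∈ Z <-> a ∈ T /\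
         exists y, maps h c y /\ maps f a y) kappa) as (s & hs & hm).
    { intros; reflexivity. }
    { intros c Y Z _ hY hZ; apply (ZFC_extensionality (ZFC_modelP V)).
      intro z; rewrite (hY z), (hZ z); tauto. }
    assert (hm' : forall c, c ∈ kappa -> forall Z, maps s c Z <->
      forall a, a ∈ Z <-> a ∈ T /\ exists y, maps h c y /\ maps f a y).
    { intros c hc; apply hm; auto.
      exact (separation (fex (fand (fmaps 3 2 0) (fmaps 4 1 0)))
        (scons c (scons h (fun _ => f))) T). }
    apply (hdiag s T).
    * split; auto; intros c Z hcZ; pose proof (function_domain hs hcZ) as hc.
      pose proof (proj1 (hm' c hc Z) hcZ) as hZ.
      assert (ZX : subset Z X) by (intros z hz; apply hZ in hz; now apply hT).
      apply small; auto; apply hW; split.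
      -- apply hP; intros z hz; auto.
      -- exists c; split; auto; intros a ha _; now apply hZ.
    * intro a; split.
      -- intro ha; assert (aS : a ∈ S) by now apply hT.
         split; [auto |].
         destruct (hS a aS) as (c & y & ca & hy & hy').
         assert (hc : c ∈ kappa) by exact (proj1 hordinal a (Sk a aS) c ca).
         destruct (function_total hs hc) as [Z hZ]; apply value_maps in hZ.
         exists c, Z; split; [| split]; auto.
         apply (proj1 (hm' c hc Z) hZ); eauto.
      -- intros (_ & c & Z & ca & hZ & aZ).
         exact (proj1 (proj1 (proj1 (hm' c (function_domain hs hZ) Z) hZ a) aZ)).
  (* [W] asks for some [c] in [kappa], even for [E]; [kappa] is nonempty because it includes the
     positive set [X]. *)
  + assert (hk : exists c, c ∈ kappa).
    { apply NNPP; intro he; apply nX, hI; intros z hz; apply he; eauto. }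
    destruct hk as [c hc].
    apply small; [apply hW; split | intros z hz; now apply hE].
    * apply hP; intros z hz; apply hX; now apply hE.
    * exists c; split; auto; intros a ha aS; apply hE in ha; tauto.
  + intro z; rewrite (hT z), (hE z); destruct (classic (z ∈ S)); auto.
- apply hW in hY; destruct hY as (_ & c & hc & hY).
  (* Members of [W] are constrained only at points of [S]. *)
  destruct (intersection_ex Y S) as [Y' hY'].
  exists Y', c; split; [| split]; auto.
  + apply (@ultrafilter_inter Y S); auto.
    * intros z hz; apply Sk; now apply hY'.
    * intros z hz hz'; now apply hY'.
  + intros a ha; apply hY' in ha; destruct ha; auto.
Qed.

(** [c] is the union of the singletons of its elements, a sequence of length [c] below [kappa]. *)
Lemma initial_segment_in_ideal c :
  contains_singletons kappa I -> is_complete kappa I -> c ∈ kappa -> c ∈ I.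
Proof.
intros hsing hcomp hc.
destruct (@function_of_partial_relation V (fupair 0 1 1) (fun _ => c)
  (fun a Z => is_upair Z a a) c) as (s & hs & hm).
{ intros; reflexivity. }
{ intros a Y Z _; apply upair_unique. }
assert (hm' : forall a, a ∈ c -> forall Z, maps s a Z <-> is_upair Z a a).
{ intros a ha; apply hm; auto; apply (ZFC_pairing (ZFC_modelP V)). }
apply (hcomp c s c hc).
- split; auto; intros a Z haZ; pose proof (function_domain hs haZ) as ha.
  apply (hsing a).
  + exact (proj1 hordinal c hc a ha).
  + now apply hm'.
- intro a; split.
  + intro ha; destruct (function_total hs ha) as [Z hZ].
    apply value_maps in hZ; exists a, Z; split; auto.
    apply (hm' a ha) in hZ; apply hZ; auto.
  + intros (a' & Z & hZ & ha); pose proof (function_domain hs hZ) as ha'.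
    apply (hm' a' ha') in hZ.
    apply hZ in ha; destruct ha; subst; auto.
Qed.

(** By linearity of [kappa], the exceptional points are [c] itself and the elements of [c]. *)
Lemma eventually_above c :
  contains_singletons kappa I -> is_complete kappa I -> c ∈ kappa ->
  almost_everywhere kappa U (fun a => c ∈ a).
Proof.
intros hsing hcomp hc.
destruct (separation (fmem 1 0) (fun _ => c) kappa) as [X hX].
change (forall a, a ∈ X <-> a ∈ kappa /\ c ∈ a) in hX.
exists X; split; auto.
destruct (difference_ex kappa X) as [N hN].
apply (@ultrafilter_complement N).
- destruct (ZFC_pairing (ZFC_modelP V) c c) as [Z hZ].
  apply (@ideal_cover N c Z).
  + now apply initial_segment_in_ideal.
  + exact (hsing c Z hc hZ).
  + intros z hz; apply hN in hz; rewrite (hX z) in hz; destruct hz as [zk nz].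
    rewrite (hZ z); destruct (proj2 hordinal z c zk hc) as [h | [h | h]]; auto.
    tauto.
- intros z hz; now apply hN.
- intro z; rewrite (hN z), (hX z); destruct (classic (c ∈ z)); tauto.
Qed.

End NormalIdeal.

(** * Reasoning almost everywhere modulo the generic ultrafilter *)

Section Ultrapower.
Variables (V : ZFC_model) (kappa I : V) (G : V -> Prop).
Hypotheses (hI : is_ideal kappa I) (hG : is_generic kappa I G).
Implicit Types a c f g h p x y : V.

Let U := generic_ultrafilter kappa I G.
Let ae := almost_everywhere kappa U.

(** Members of [U] are sets of [V], whereas [P] is a predicate of the metatheory; this side
    condition is discharged by Separation for an explicit formula. *)
Definition trace_exists (P : V -> Prop) : Prop :=
  exists X : V, forall a, a ∈ X <-> a ∈ kappa /\ P a.

Lemma ae_and (P Q R : V -> Prop) :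
  ae P -> ae Q -> trace_exists R ->
  (forall a, a ∈ kappa -> P a -> Q a -> R a) -> ae R.
Proof.
intros (X & UX & hX) (Y & UY & hY) [Z hZ] h; exists Z; split; auto.
apply (ultrafilter_inter hI hG UX UY).
- intros a ha; now apply hZ.
- intros a ha ha'; apply hX in ha; apply hY in ha'; apply hZ; split; [tauto |].
  apply h; tauto.
Qed.

Lemma ae_weaken (P R : V -> Prop) :
  ae P -> trace_exists R -> (forall a, a ∈ kappa -> P a -> R a) -> ae R.
Proof. intros hP hR h; apply (ae_and hP hP hR); auto. Qed.

Lemma ae_everywhere (R : V -> Prop) :
  trace_exists R -> (forall a, a ∈ kappa -> R a) -> ae R.
Proof.
intros hR h; destruct hG as (hc & [c Gc] & _).
destruct (hc c Gc) as (X & hX & _).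
apply (@ae_weaken (fun a => a ∈ X)); auto.
exists X; split; [now exists c |]; intro a; split; [| tauto].
intro ha; split; auto; now apply (proj1 hX).
Qed.

(** [U] contains either the trace of [Q] or its complement, on which [P] yields [R]. *)
Lemma ae_or (P Q R : V -> Prop) :
  ae P -> trace_exists Q -> trace_exists R ->
  (forall a, a ∈ kappa -> P a -> Q a \/ R a) -> ae Q \/ ae R.
Proof.
intros hP [X hX] hR h; destruct (difference_ex kappa X) as [Y hY].
destruct (@ultrafilter_ultra V kappa I hI G hG X Y) as [UX | UY].
- intro a; rewrite (hY a), (hX a); destruct (classic (Q a)); tauto.
- left; now exists X.
- right; apply (@ae_and P (fun a => ~ Q a) R); auto.
  + exists Y; split; auto; intro a; rewrite (hY a), (hX a); tauto.
  + intros a ha hPa nQ; destruct (h a ha hPa); tauto.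
Qed.

Lemma trace_eq f g :
  trace_exists (fun a => exists y, value f a y /\ value g a y).
Proof.
exact (separation (fex (fand (fvalue 2 1 0) (fvalue 3 1 0)))
  (scons f (fun _ => g)) kappa).
Qed.

Lemma trace_mem f g :
  trace_exists (fun a => exists y z, value f a y /\ value g a z /\ y ∈ z).
Proof.
exact (separation
  (fex (fex (fand (fvalue 3 2 1) (fand (fvalue 4 2 0) (fmem 1 0)))))
  (scons f (fun _ => g)) kappa).
Qed.

Lemma ultra_eq_intro f g :
  is_function f kappa ->
  (forall a y, value f a y -> value g a y) -> ultra_eq kappa U f g.
Proof.
intros hf h; apply ae_everywhere; [apply trace_eq |].
intros a ha; destruct (function_total hf ha) as [y hy]; eauto.
Qed.

Lemma ultra_eq_sym f g : ultra_eq kappa U f g -> ultra_eq kappa U g f.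
Proof.
intro h; apply (ae_weaken h); [apply trace_eq |].
intros a _ (y & h1 & h2); eauto.
Qed.

Lemma ultra_eq_trans f g h :
  ultra_eq kappa U f g -> ultra_eq kappa U g h -> ultra_eq kappa U f h.
Proof.
intros e e'; apply (ae_and e e'); [apply trace_eq |].
intros a _ (y & h1 & h2) (z & h3 & h4).
rewrite (value_unique h3 h2) in h4; eauto.
Qed.

Lemma ultra_mem_eq f f' g g' :
  ultra_eq kappa U f f' -> ultra_eq kappa U g g' ->
  ultra_mem kappa U f g -> ultra_mem kappa U f' g'.
Proof.
intros ef eg hm.
assert (hm' : ultra_mem kappa U f' g).
{ apply (ae_and ef hm); [apply trace_mem |].
  intros a _ (y & h1 & h2) (y' & z & h3 & h4 & h5).
  rewrite (value_unique h3 h1) in h5; eauto 6. }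
apply (ae_and eg hm'); [apply trace_mem |].
intros a _ (z & h1 & h2) (y & z' & h3 & h4 & h5).
rewrite (value_unique h4 h1) in h5; eauto 6.
Qed.

(** * Equality, membership and pairs in the ultrapower *)

Notation Ult := (ultrapower kappa U).
Notation cls hf := (@represented_by V kappa U _ hf).

Lemma cls_surj (x : Ult) : exists f (hf : is_function f kappa), x = cls hf.
Proof.
destruct x as [c (f & hf & hc)]; exists f, hf; unfold represented_by.
subst c; f_equal; apply proof_irrelevance.
Qed.

Lemma cls_eq f g (hf : is_function f kappa) (hg : is_function g kappa) :
  cls hf = cls hg <-> ultra_eq kappa U f g.
Proof.
split.
- intro e.
  assert (hr : represents g (cls hf)).
  { rewrite e; split; auto; now apply ultra_eq_intro. }
  apply hr.
- intro e; assert (ec : function_class kappa U f = function_class kappa U g).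
  { apply functional_extensionality; intro k; apply propositional_extensionality.
    split; intros [hk e']; split; auto.
    - apply (ultra_eq_trans (ultra_eq_sym e) e').
    - apply (ultra_eq_trans e e'). }
  unfold represented_by; apply eq_sig_hprop; auto.
  intros; apply proof_irrelevance.
Qed.

Lemma cls_mem f g (hf : is_function f kappa) (hg : is_function g kappa) :
  mem (s := Ult) (cls hf) (cls hg) <-> ultra_mem kappa U f g.
Proof.
split.
- intros (f' & g' & [_ e] & [_ e'] & h).
  exact (ultra_mem_eq (ultra_eq_sym e) (ultra_eq_sym e') h).
- intro h; exists f, g; split; [| split]; auto;
    split; auto; now apply ultra_eq_intro.
Qed.

(** Pointwise pairs represent pairs. A function almost everywhere in the pair equals [f] or [g] at
    each such point, and [ae_or] makes one alternative hold almost everywhere. *)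
Lemma cls_upair f g h (hf : is_function f kappa) (hg : is_function g kappa)
    (hh : is_function h kappa) :
  (forall a x y p, value f a x -> value g a y -> value h a p ->
    is_upair p x y) ->
  is_upair (V := Ult) (cls hh) (cls hf) (cls hg).
Proof.
intros hp z; destruct (cls_surj z) as (k & hk & ->).
rewrite cls_mem, !cls_eq; split.
- intro hm; apply (ae_or hm); try apply trace_eq.
  intros a ha (y & p & hy & hpa & hyp).
  destruct (function_total hf ha) as [u hu], (function_total hg ha) as [v hv].
  apply (hp a u v p hu hv hpa) in hyp; destruct hyp; subst; eauto.
- intros [e | e]; apply (ae_weaken e); try apply trace_mem;
    intros a ha (y & hy & hy');
    destruct (function_total hf ha) as [u hu], (function_total hg ha) as [v hv],
      (function_total hh ha) as [p hpa];
    exists y, p; split; [| split | | split]; auto;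
    apply (hp a u v p hu hv hpa).
  + left; exact (value_unique hy' hu).
  + right; exact (value_unique hy' hv).
Qed.

(** The Kuratowski pair is formed twice, pointwise and in the ultrapower, from the same three
    pairing functions; the pointwise clause later allows comparison with elements of a function of
    [V]. *)
Lemma ordered_pairing_function_ex f g (hf : is_function f kappa)
    (hg : is_function g kappa) :
  exists q (hq : is_function q kappa),
    is_opair (V := Ult) (cls hq) (cls hf) (cls hg) /\
    forall a x y p, value f a x -> value g a y -> value q a p ->
      is_opair p x y.
Proof.
destruct (pairing_function_ex hf hf) as (s & hs & es).
destruct (pairing_function_ex hf hg) as (u & hu & eu).
destruct (pairing_function_ex hs hu) as (q & hq & eq).
exists q, hq; split.
- exists (cls hs), (cls hu); split; [| split]; now apply cls_upair.
- intros a x y p hx hy hp.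
  pose proof (function_domain hf (value_maps hx)) as ha.
  destruct (function_total hs ha) as [sa hsa], (function_total hu ha) as [ua hua].
  exists sa, ua; split; [| split]; eauto.
Qed.

(* Los's theorem is avoided: an element [(g, h)] of the class of [constant F] is
   split into its two coordinates, and only the fact that pairing functions
   represent pairs, which needs no choice, is used. *)
Lemma constant_class_value (F : V) (hF : is_function F kappa) :
  value (V := Ult) (ultrapower_embedding kappa U F) (ultrapower_kappa kappa U)
    (cls hF).
Proof.
unfold ultrapower_embedding, ultrapower_kappa.
generalize (proj2 (constant_functionP kappa F)) as vF.
generalize (proj1 (constant_functionP kappa F)) as hC.
generalize (constant_function kappa F) as C; intros C hC vC.
generalize (proj2 (identity_functionP kappa)) as vid.
generalize (proj1 (identity_functionP kappa)) as hid.
generalize (identity_function kappa) as id; intros id hid vid.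
intro z; split.
- intros (p & hp & hpm).
  destruct (cls_surj p) as (q & hq & ->), (cls_surj z) as (k & hk & ->).
  apply cls_mem in hpm; apply cls_eq.
  destruct (projections_ex hq) as (g & h & hg & hh & egh).
  destruct (ordered_pairing_function_ex hg hh) as (q' & hq' & oq & eq').
  (* Almost every value of [q] is an element of [F], hence an ordered pair, and [q'] reassembles it
     from its coordinates. *)
  assert (e : cls hq = cls hq').
  { apply cls_eq, (ae_weaken hpm); [apply trace_eq |].
    intros a ha (x & F' & hx & hF' & hxF).
    rewrite (value_unique hF' (vC a ha)) in hxF.
    destruct (proj1 hF x hxF) as (u & v & _ & hx').
    destruct (egh a x u v hx hx') as [hu hv].
    destruct (function_total hq' ha) as [x' hx''].
    exists x; split; auto.
    now rewrite (opair_unique hx' (eq' a u v x' hu hv hx'')). }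
  rewrite <- e in oq.
  (* Comparing the two decompositions, [g] is the identity and [h] is [k] almost everywhere; as the
     pair [(g a, h a)] is in [F], [h a] is the value of [F] at [a]. *)
  destruct (structure_opair_inj hp oq) as [e1 e2].
  apply cls_eq in e1; apply cls_eq in e2.
  apply (ultra_eq_trans e2), (ae_and hpm e1); [apply trace_eq |].
  intros a ha (x & F' & hx & hF' & hxF) (a' & ha' & hga).
  rewrite <- (value_unique (vid a ha) ha') in hga.
  rewrite (value_unique hF' (vC a ha)) in hxF.
  destruct (proj1 hF x hxF) as (u & v & _ & hx').
  destruct (egh a x u v hx hx') as [hu hv].
  rewrite (value_unique hu hga) in hx'.
  exists v; split; auto; apply (maps_value hF); now exists x.
- intros ->.
  destruct (ordered_pairing_function_ex hid hF) as (q & hq & oq & eq).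
  exists (cls hq); split; auto.
  apply cls_mem, ae_everywhere; [apply trace_mem |].
  intros a ha; destruct (function_total hq ha) as [p hp].
  destruct (function_total hF ha) as [y hy].
  exists p, F; split; [| split]; auto.
  destruct (value_maps hy) as (p' & hp' & hpF).
  now rewrite (opair_unique (eq a a y p (vid a ha) hy hp) hp').
Qed.

End Ultrapower.

(** * Canonical reflection functions represent pointwise images *)

Theorem proposition2p3 (V : ZFC_model) (kappa kplus I : V) (b : V -> V)
    (G : V -> Prop)
    (h_kappa : is_regular_cardinal kappa)
    (h_kplus : is_successor_cardinal kappa kplus)
    (h_I : is_normal_ideal kappa I)
    (h_b : reflection_bijections kappa kplus b)
    (h_G : is_generic kappa I G)
    (xi : V) (h_xi : mem xi kplus) :
  let U := generic_ultrafilter kappa I G in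
  let j := ultrapower_embedding kappa U in
  let F := reflection_function kappa b xi in
  exists x : ultrapower kappa U,
    represents F x /\
    value (j F) (ultrapower_kappa kappa U) x /\
    is_pointwise_image xi x.
Proof.
intros U j F.
destruct h_I as (hI & hsing & hcomp & hdiag).
pose proof (proj1 (proj1 h_kappa)) as hord.
destruct (reflection_functionP kappa b xi) as (hF & Fsmall & Flarge).
fold F in hF, Fsmall, Flarge.
exists (represented_by U hF); split; [| split].
- split; auto; now apply (ultra_eq_intro hI h_G).
- now apply constant_class_value.
- assert (habove : forall c, c ∈ kappa ->
    almost_everywhere kappa U (fun a => c ∈ a)).
  { intros c hc; now apply (eventually_above hI h_G). }
  (* An enumeration [h] of [xi] with domain [d] included in [kappa], such that
     [F a = h[a]] for almost all [a]. *)
  assert (key : exists h d, function_to h d xi /\ subset d kappa /\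
    (forall y, y ∈ xi -> exists c, maps h c y) /\
    (forall a c y s, maps h c y -> c ∈ a -> value F a s -> y ∈ s) /\
    (forall f, ultra_mem kappa U f F ->
       almost_everywhere kappa U
         (fun a => exists c y, c ∈ a /\ maps h c y /\ maps f a y))).
  { assert (htrace : forall h f, trace_exists kappa
      (fun a => exists c y, c ∈ a /\ maps h c y /\ maps f a y)).
    { intros h f.
      exact (separation (fex (fex (fand (fmem 1 2)
        (fand (fmaps 3 1 0) (fmaps 4 2 0))))) (scons h (fun _ => f)) kappa). }
    destruct (classic (xi ∈ kappa)) as [hxi | hxi].
    - destruct (identity_function_ex xi) as (h & hh & hid).
      assert (hfix : forall c y, maps h c y -> c ∈ xi /\ y = c).
      { intros c y hcy; pose proof (function_domain hh hcy) as hc.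
        split; auto; now apply (hid c hc). }
      exists h, xi; split; [| split; [| split; [| split]]].
      + split; auto; intros c y hcy; now destruct (hfix c y hcy) as [? ->].
      + exact (proj1 hord xi hxi).
      + intros y hy; exists y; exact (value_maps (hid y hy)).
      + intros a c y s hcy _ hs; destruct (hfix c y hcy) as [hc ->].
        pose proof (function_domain hF (value_maps hs)) as ha.
        now rewrite (value_unique hs (Fsmall hxi a ha)).
      (* Here [F a = xi] is [h[a]] only once [xi ∈ a]; transitivity then puts the value of [f] at
         [a] into [a], so it serves as its own index [c]. *)
      + intros f hf; apply (ae_and hI h_G hf (habove xi hxi) (htrace h f)).
        intros a ha (y & s & hy & hs & hys) hxia.
        rewrite (value_unique hs (Fsmall hxi a ha)) in hys.
        exists y, y; split; [| split; apply value_maps; auto].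
        exact (ordinal_mem_trans hord ha hys hxia).
    - assert (hle : ordinal_le kappa xi).
      { destruct h_kplus as ((hkplus & _) & hk & _).
        destruct (proj2 hkplus kappa xi hk h_xi) as [e | [e | e]];
          [left | right |]; tauto. }
      destruct (proj1 h_b xi hle h_xi) as [hh honto].
      exists (b xi), kappa; split; [| split; [| split; [| split]]]; auto.
      + intros c hc; exact hc.
      + intros y hy; destruct (honto y hy) as (c & hc & _); eauto.
      + intros a c y s hcy hca hs.
        pose proof (function_domain hF (value_maps hs)) as ha.
        destruct (Flarge hxi a ha) as (s' & hs' & him).
        rewrite (value_unique hs hs'); apply him; eauto.
      (* Here [F a] is the image of [a] under [b xi] at every [a], so the index comes directly from
         the definition of the image. *)
      + intros f hf; apply (ae_weaken hI h_G hf (htrace (b xi) f)).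
        intros a ha (y & s & hy & hs & hys).
        destruct (Flarge hxi a ha) as (s' & hs' & him).
        rewrite (value_unique hs hs') in hys; apply him in hys.
        destruct hys as (c & hc & hcy); exists c, y; split; [| split]; auto.
        exact (value_maps hy). }
  destruct key as (h & d & [hh hval] & hd & honto & hsub & hpress).
  intro z; destruct (cls_surj z) as (f & hf & ->); split.
  + intro hz; apply (cls_mem hI h_G), hpress in hz.
    destruct hz as (S & US & hS).
    destruct (@pressing_down V kappa I hI G h_G hord f h S hdiag US)
      as (Y & c & UY & hc & hY).
    { intros a ha; now apply hS. }
    (* A point of the positive set [Y] is needed to know that [h] is defined at [c]; its value there
       is the required [eta]. *)
    assert (hY0 : exists a, a ∈ Y).
    { apply NNPP; intro hn; apply (ultrafilter_positive hI h_G UY), hI.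
      intros a ha; eauto. }
    destruct hY0 as [a0 ha0]; destruct (hY a0 ha0) as (eta & heta & _).
    exists eta; split; [eauto |].
    apply (cls_eq hI h_G).
    apply (@ae_weaken V kappa I G hI h_G (fun a => a ∈ Y)).
    * exists Y; split; auto; intro a; split; [| tauto].
      intro ha; split; auto; exact (ultrafilter_subset UY ha).
    * apply trace_eq.
    * intros a ha haY; destruct (hY a haY) as (y & hcy & hfy).
      rewrite (maps_unique hh hcy heta) in hfy.
      exists eta; split; [exact (maps_value hf hfy) |].
      now apply constant_functionP.
  (* With [eta = h c], the value [eta] lies in [F a] for every [a] with [c ∈ a], hence almost
     everywhere. *)
  + intros (eta & heta & ->); destruct (honto eta heta) as [c hc].
    apply (cls_mem hI h_G).
    apply (ae_weaken hI h_G (habove c (hd c (function_domain hh hc))));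
      [apply trace_mem |].
    intros a ha hca; destruct (function_total hF ha) as [s hs].
    exists eta, s; split; [| split]; auto; [| eauto].
    now apply constant_functionP.
Qed.
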